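(* Let $G$ be a finite simple graph with $|V(G)|\ge 3$. Then the quantum graph $\mathcal U_G$ admits nonlocal symmetry.
   Context: A finite simple graph is undirected, with no loops or multiple edges; $x\sim y$ means adjacency, and $x\not\sim x$ for every vertex. Let $n=|V(G)|$. Bi-unitary: for a unital $C^*$-algebra $\mathcal B$, a matrix $U=(u_{a,x})\in M_n(\mathcal B)$ is a bi-unitary if both $U$ and $U^t=(u_{x,a})$ (entries transposed, without taking adjoints) are unitary in $M_n(\mathcal B)$. Quantum graph and game algebra: $\mathcal U_G=\mathrm{span}\{e_x\otimes e_y: x\sim y\}\subset \mathbb C^{V(G)}\otimes\mathbb C^{V(G)}$. Consider the universal unital $C^*$-algebra generated by elements $u_{a,x}$, $a,x\in V(G)$, subject to the relations that $U=(u_{a,x})$ is a bi-unitary and $u_{a,x}u_{b,y}^*=0$ whenever ($x\sim y$ and $a\not\sim b$) or ($x\not\sim y$ and $a\sim b$). The algebra $C(\mathrm{Qut}(\mathcal U_G))=\mathcal A(\mathrm{Iso}(\mathcal U_G,\mathcal U_G))$ is its $C^*$-subalgebra generated by all the words $u_{a,x}^*u_{b,y}$, $a,b,x,y\in V(G)$. Perfect strategies: let $\epsilon_{x,x'}$ denote the matrix units of $M_n$ (indexed by $V(G)$). A tracial state $\tau$ on $C(\mathrm{Qut}(\mathcal U_G))$ defines a linear map $\Gamma_\tau:M_n\otimes M_n\to M_n\otimes M_n$ by $$\Gamma_\tau(\epsilon_{x,x'}\otimes\epsilon_{y,y'})=\sum_{a,a',b,b'}\tau\bigl(u_{a,x}^*u_{a',x'}u_{b',y'}^*u_{b,y}\bigr)\,\epsilon_{a,a'}\otimes\epsilon_{b,b'}.$$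 The perfect (quantum commuting) quantum no-signalling (QNS) correlations for the automorphism game $\mathrm{Iso}(\mathcal U_G,\mathcal U_G)$ are exactly the maps $\Gamma_\tau$. Such a correlation $\Gamma$ is local if $\Gamma=\Gamma_{\tau'}$ for some tracial state $\tau'$ of the form $\tau'=f\circ\pi$, where $\pi:C(\mathrm{Qut}(\mathcal U_G))\to\mathcal A$ is a $*$-homomorphism into an abelian $C^*$-algebra $\mathcal A$ and $f$ is a state on $\mathcal A$. Nonlocal symmetry: $\mathcal U_G$ admits nonlocal symmetry if there is a perfect QNS correlation for the automorphism game $\mathrm{Iso}(\mathcal U_G,\mathcal U_G)$ which is not local. *)

(* Defs.v *)
(* MathComp, with the abstract real numbers of MathComp-Analysis. *)
From HB Require Import structures.
From mathcomp Require Import all_boot all_order all_algebra.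
From mathcomp Require Import complex mxtens.
From mathcomp Require Import all_classical all_reals.

Set Implicit Arguments.
Unset Strict Implicit.
Unset Printing Implicit Defensive.

Import Order.TTheory GRing.Theory Num.Theory.

Local Open Scope classical_set_scope.
Local Open Scope ring_scope.

(* Unital C*-algebras over R[i]. The norm is a field of the mixin, with values
   in R, because Hierarchy Builder refuses a new join of the ring structures
   with the normed structures (NumDomain is already such a join); completeness,
   and closedness below, are therefore written with sequences. An algType is
   never the zero ring; this loses nothing here, since the zero algebra has no
   state and every algebra has a unital morphism to it. *)
HB.mixin Record Algebra_isCstar (R : realType) A of GRing.Algebra R[i] A := {
  star : A -> A;
  cnorm : A -> R;
  starK : involutive star;
  starD : {morph star : x y / x + y};
  starZ : forall (c : R[i]) x, star (c *: x) = c^* *: star x;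
  starM : forall x y, star (x * y) = star y * star x;
  cnormD : forall x y, cnorm (x + y) <= cnorm x + cnorm y;
  cnormZ : forall (c : R[i]) x, cnorm (c *: x) = Normc.normc c * cnorm x;
  cnorm0_eq0 : forall x, cnorm x = 0 -> x = 0;
  cnormM : forall x y, cnorm (x * y) <= cnorm x * cnorm y;
  cnorm_starM : forall x, cnorm (star x * x) = cnorm x ^+ 2;
  cnorm_complete : forall x_ : nat -> A,
    (forall eps : R, 0 < eps -> exists N, forall m n, (N <= m)%N -> (N <= n)%N ->
       cnorm (x_ m - x_ n) < eps) ->
    exists l, forall eps : R, 0 < eps -> exists N, forall n, (N <= n)%N ->
       cnorm (x_ n - l) < eps
}.

#[short(type="cstarType")]
HB.structure Definition Cstar (R : realType) :=
  {A of Algebra_isCstar R A & GRing.Algebra R[i] A}.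

Section CstarBasics.
Variables (R : realType).

(* *-homomorphisms, not assumed unital. *)
Record star_morphism (A B : cstarType R) (f : {linear A -> B}) : Prop :=
  StarMorphism {
    star_morphismM : {morph f : x y / x * y};
    star_morphism_star : {morph f : x / star x}
  }.

Definition ccvg (A : cstarType R) (x_ : nat -> A) (l : A) : Prop :=
  forall eps : R, 0 < eps -> exists N, forall n, (N <= n)%N ->
    cnorm (x_ n - l) < eps.

Record state (A : cstarType R) (f : {scalar A}) : Prop := State {
  state_ge0 : forall x, 0 <= f (star x * x);
  state1 : f 1 = 1
}.

Record tracial_state (A : cstarType R) (f : {scalar A}) : Prop := TracialState {
  tracial_state_state :> state f;
  tracial_stateC : forall x y, f (x * y) = f (y * x)
}.

Definition abelian_cstar (A : cstarType R) : Prop :=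
  commutative (fun x y : A => x * y).

Record cstar_subalg (A : cstarType R) (D : set A) : Prop := CstarSubalg {
  cstar_subalg1 : D 1;
  cstar_subalgD : forall x y, D x -> D y -> D (x + y);
  cstar_subalgZ : forall (c : R[i]) x, D x -> D (c *: x);
  cstar_subalgM : forall x y, D x -> D y -> D (x * y);
  cstar_subalg_star : forall x, D x -> D (star x);
  cstar_subalg_closed : forall (x_ : nat -> A) l,
    (forall n, D (x_ n)) -> ccvg x_ l -> D l
}.

Definition cstar_gen (A : cstarType R) (S : set A) : set A :=
  smallest (@cstar_subalg A) S.

Lemma cstar_gen_subalg (A : cstarType R) (S : set A) : cstar_subalg (cstar_gen S).
Proof.
split=> [D [sD _]|x y Dx Dy D DS|c x Dx D DS|x y Dx Dy D DS|x Dx D DS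
        |x_ l Dx xl D DS].
- exact: cstar_subalg1 sD.
- exact: (cstar_subalgD DS.1 (Dx _ DS) (Dy _ DS)).
- exact: (cstar_subalgZ DS.1 c (Dx _ DS)).
- exact: (cstar_subalgM DS.1 (Dx _ DS) (Dy _ DS)).
- exact: (cstar_subalg_star DS.1 (Dx _ DS)).
- by apply: (cstar_subalg_closed DS.1 _ xl) => n; exact: Dx.
Qed.

Lemma sub_cstar_gen (A : cstarType R) (S : set A) : S `<=` cstar_gen S.
Proof. exact: sub_gen_smallest. Qed.

End CstarBasics.

(* The C*-subalgebra of A generated by S and 1, as a C*-algebra of its own. *)
Section CstarSub.
Variables (R : realType) (A : cstarType R) (S : set A).

Definition cstar_gen_pred : pred A := fun x => `[< cstar_gen S x >].

Lemma cstar_gen_subalg_closed : GRing.subsemialg_closed cstar_gen_pred.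
Proof.
have gS := cstar_gen_subalg S.
split.
- apply/asboolP; exact: cstar_subalg1 gS.
- split; first apply/asboolP.
    rewrite -(scale0r (1 : A)).
    exact: (cstar_subalgZ gS 0 (cstar_subalg1 gS)).
  move=> x y /asboolP Dx /asboolP Dy; apply/asboolP.
  exact: (cstar_subalgD gS Dx Dy).
- by move=> c x /asboolP Dx; apply/asboolP; exact: (cstar_subalgZ gS c Dx).
- move=> x y /asboolP Dx /asboolP Dy; apply/asboolP.
  exact: (cstar_subalgM gS Dx Dy).
Qed.

HB.instance Definition _ :=
  GRing.isSubalgClosed.Build R[i] A cstar_gen_pred cstar_gen_subalg_closed.

Definition cstar_sub : Type := {x : A | cstar_gen_pred x}.
HB.instance Definition _ := SubChoice.on cstar_sub.
HB.instance Definition _ := [SubChoice_isSubAlgebra of cstar_sub by <:].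

Lemma cstar_subP (x : cstar_sub) : cstar_gen S (val x).
Proof. by apply/asboolP; exact: (valP x). Qed.

Definition to_cstar_sub (x : A) (Sx : cstar_gen S x) : cstar_sub :=
  exist _ x (asboolT Sx).

Definition cstar_sub_star (x : cstar_sub) : cstar_sub :=
  to_cstar_sub (cstar_subalg_star (cstar_gen_subalg S) (cstar_subP x)).

Definition cstar_sub_norm (x : cstar_sub) : R := cnorm (val x).

Lemma cstar_sub_complete (x_ : nat -> cstar_sub) :
  (forall eps : R, 0 < eps -> exists N, forall m n, (N <= m)%N -> (N <= n)%N ->
     cstar_sub_norm (x_ m - x_ n) < eps) ->
  exists l, forall eps : R, 0 < eps -> exists N, forall n, (N <= n)%N ->
     cstar_sub_norm (x_ n - l) < eps.
Proof.
move=> x_cauchy; have [l xl] := @cnorm_complete R A (fun n => val (x_ n)) x_cauchy.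
have Sl : cstar_gen S l.
  apply: (cstar_subalg_closed (cstar_gen_subalg S) _ xl) => n.
  exact: cstar_subP.
by exists (to_cstar_sub Sl).
Qed.

Let cstar_sub_starK : involutive cstar_sub_star.
Proof. by move=> x; apply/val_inj; exact: starK. Qed.

Let cstar_sub_starD : {morph cstar_sub_star : x y / x + y}.
Proof. by move=> x y; apply/val_inj; exact: starD. Qed.

Let cstar_sub_starZ (c : R[i]) x :
  cstar_sub_star (c *: x) = c^* *: cstar_sub_star x.
Proof. by apply/val_inj; exact: starZ. Qed.

Let cstar_sub_starM x y :
  cstar_sub_star (x * y) = cstar_sub_star y * cstar_sub_star x.
Proof. by apply/val_inj; exact: starM. Qed.

Let cstar_sub_normD x y :
  cstar_sub_norm (x + y) <= cstar_sub_norm x + cstar_sub_norm y.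
Proof. exact: cnormD. Qed.

Let cstar_sub_normZ (c : R[i]) x :
  cstar_sub_norm (c *: x) = Normc.normc c * cstar_sub_norm x.
Proof. exact: cnormZ. Qed.

Let cstar_sub_norm0_eq0 x : cstar_sub_norm x = 0 -> x = 0.
Proof. by move=> x0; apply/val_inj; exact: cnorm0_eq0. Qed.

Let cstar_sub_normM x y :
  cstar_sub_norm (x * y) <= cstar_sub_norm x * cstar_sub_norm y.
Proof. exact: cnormM. Qed.

Let cstar_sub_norm_starM x :
  cstar_sub_norm (cstar_sub_star x * x) = cstar_sub_norm x ^+ 2.
Proof. exact: cnorm_starM. Qed.

HB.instance Definition _ := Algebra_isCstar.Build R cstar_sub
  cstar_sub_starK cstar_sub_starD cstar_sub_starZ cstar_sub_starM
  cstar_sub_normD cstar_sub_normZ cstar_sub_norm0_eq0 cstar_sub_normM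
  cstar_sub_norm_starM cstar_sub_complete.

End CstarSub.

Section Biunitary.
Variables (R : realType) (B : cstarType R) (n : nat).
Implicit Types U : 'M[B]_n.

Definition adjmx U : 'M[B]_n := \matrix_(i, j) star (U j i).

Definition is_unitary U : Prop :=
  adjmx U *m U = 1%:M /\ U *m adjmx U = 1%:M.

Definition is_biunitary U : Prop := is_unitary U /\ is_unitary U^T.

End Biunitary.

(* G is a simple graph on V with adjacency relation e; the matrix (u_{a,x}) is
   indexed through the enumeration of V. *)
Section GraphGame.
Variables (R : realType) (V : finType) (e : rel V).

Definition vmx (B : cstarType R) (u : V -> V -> B) : 'M[B]_#|V| :=
  \matrix_(i, j) u (enum_val i) (enum_val j).

Record iso_relations (B : cstarType R) (u : V -> V -> B) : Prop := IsoRelations {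
  iso_biunitary : is_biunitary (vmx u);
  iso_edge : forall a b x y, e x y -> ~~ e a b -> u a x * star (u b y) = 0;
  iso_nonedge : forall a b x y, ~~ e x y -> e a b -> u a x * star (u b y) = 0
}.

(* (A, u) is the universal unital C*-algebra generated by elements u a x subject
   to iso_relations. It is determined up to isomorphism: generation makes phi
   unique, as morphisms of C*-algebras are contractive. *)
Record iso_universal (A : cstarType R) (u : V -> V -> A) : Prop := IsoUniversal {
  iso_universal_rel : iso_relations u;
  iso_universal_gen : cstar_gen [set u ax.1 ax.2 | ax in [set: V * V]] = [set: A];
  iso_universal_map : forall (B : cstarType R) (v : V -> V -> B),
    iso_relations v ->
    exists phi : {lrmorphism A -> B},
      star_morphism phi /\ forall a x, phi (u a x) = v a x
}.

Variables (A : cstarType R) (u : V -> V -> A).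

Definition qut_words : set A :=
  [set star (u p.1.1 p.1.2) * u p.2.1 p.2.2 | p in [set: (V * V) * (V * V)]].

(* C(Qut(U_G)) for (A, u) as in iso_universal. Adjoining 1 changes nothing when
   V is inhabited: 1 is the sum over a of the words star (u a x) * u a x. *)
Definition qut : cstarType R := cstar_sub qut_words.

Lemma qut_wordP a x b y : qut_words (star (u a x) * u b y).
Proof. by exists ((a, x), (b, y)). Qed.

Definition qut_word a x b y : qut :=
  to_cstar_sub (sub_cstar_gen (qut_wordP a x b y)).

Local Notation n := #|V|.

Definition mxunit (x y : V) : 'M[R[i]]_n := delta_mx (enum_rank x) (enum_rank y).

(* Gamma is the map Gamma_tau given by tau, with M_n (x) M_n realised by the Kronecker product. *)
Definition implements (tau : {scalar qut})
    (Gamma : {linear 'M[R[i]]_(n * n) -> 'M[R[i]]_(n * n)}) : Prop :=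
  forall x x' y y',
    Gamma (mxunit x x' *t mxunit y y') =
    \sum_a \sum_a' \sum_b \sum_b'
      tau (qut_word a x a' x' * qut_word b' y' b y) *:
        (mxunit a a' *t mxunit b b').

Definition perfect_QNS
    (Gamma : {linear 'M[R[i]]_(n * n) -> 'M[R[i]]_(n * n)}) : Prop :=
  exists tau : {scalar qut}, tracial_state tau /\ implements tau Gamma.

(* tau = f o pi with f a state on an abelian C*-algebra. Since pi need not be
   unital, codomains without unit are covered by passing to the unitization. *)
Definition factors_abelian (tau : {scalar qut}) : Prop :=
  exists (B : cstarType R) (pi : {linear qut -> B}) (f : {scalar B}),
    [/\ abelian_cstar B, star_morphism pi, state f & forall w, tau w = f (pi w)].

Definition local_QNS
    (Gamma : {linear 'M[R[i]]_(n * n) -> 'M[R[i]]_(n * n)}) : Prop :=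
  exists tau : {scalar qut},
    [/\ tracial_state tau, factors_abelian tau & implements tau Gamma].

Definition nonlocal_symmetry : Prop :=
  exists Gamma : {linear 'M[R[i]]_(n * n) -> 'M[R[i]]_(n * n)},
    perfect_QNS Gamma /\ ~ local_QNS Gamma.

End GraphGame.

(* Main.v *)
(* Any family of unitaries [w_x] makes the diagonal matrix [u_(a,x) = w_x] if
   [a = x], and [0] otherwise, satisfy the relations of the game, whatever the
   graph. Choose distinct vertices [p], [q], [r], put [w_q = X], [w_r = Z] (Pauli
   matrices) and [w_x = 1] elsewhere, and let [tau] be the normalised trace of
   [M_2] pulled back to C(Qut(U_G)). With [c_xy = u_xx^* u_yy], the correlation
   of [tau] records in particular
     tau(c_pq^2) = tau(c_pr^2) = 1  and  tau(c_qr^2) = -1.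
   If a tracial state [t] has the same correlation, then modulo its null ideal
   [c_pq = c_qp], [c_pr = c_rp], [c_qr = - c_rq], [c_qr = c_qp c_pr] and
   [c_rq = c_rp c_pq]. If moreover [t] factors through an abelian algebra, then
   [c_rq = c_pr c_qp = c_qp c_pr = c_qr], hence [c_qr] is null, contradicting
   [t(c_rq c_qr) = 1]. *)
Require Import Defs.
From HB Require Import structures.
From mathcomp Require Import all_boot all_order all_algebra.
From mathcomp Require Import complex mxtens.
From mathcomp Require Import all_classical all_reals.
From mathcomp Require Import ring lra.

Set Implicit Arguments.
Unset Strict Implicit.
Unset Printing Implicit Defensive.

Import Order.TTheory GRing.Theory Num.Theory.

Local Open Scope classical_set_scope.
Local Open Scope ring_scope.
Local Open Scope complex_scope.

(** * Completeness of the reals, for sequences *)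

(** The limit is the lower limit: the supremum of the set [S] of numbers eventually below the
    sequence. If the tail from [N] varies by less than [eps], then [x N - eps] lies in [S] and
    [x N + eps] bounds [S]. *)
Lemma cauchy_real_lim (R : realType) (x : nat -> R) :
  (forall eps, 0 < eps -> exists N, forall m n, (N <= m)%N -> (N <= n)%N ->
     `|x m - x n| < eps) ->
  exists l, forall eps, 0 < eps -> exists N, forall n, (N <= n)%N ->
     `|x n - l| < eps.
Proof.
move=> xC; pose S := [set y | exists N, forall n, (N <= n)%N -> y <= x n].
have lbS N eps : (forall m n, (N <= m)%N -> (N <= n)%N -> `|x m - x n| < eps) ->
  S (x N - eps) /\ ubound S (x N + eps).
  move=> xN; split.
    by exists N => n Nn; have := xN N n (leqnn N) Nn; rewrite ltr_norml; lra.
  move=> y [M yM]; have := yM _ (leq_maxr N M).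
  by have := xN N _ (leqnn N) (leq_maxl N M); rewrite ltr_norml; lra.
have [N1 /lbS [S1 U1]] := xC 1 ltr01.
have hS : has_sup S by split; [exists (x N1 - 1) | exists (x N1 + 1)].
exists (sup S) => eps eps0.
have [N xN] := xC (eps / 2) ltac:(lra).
have [SN UN] := lbS _ _ xN.
exists N => n Nn.
have h1 := sup_upper_bound hS SN.
have h2 := ge_sup (ex_intro _ _ S1) UN.
have := xN n N Nn (leqnn N); rewrite !ltr_norml; lra.
Qed.

(** * The Euclidean norm on complex row vectors *)

Section RowNorm.
Variable R : realType.
Implicit Type n : nat.

Lemma real_complexM (x y : R) : (x * y)%:C = x%:C * y%:C.
Proof. exact: rmorphM. Qed.

Lemma real_complexD (x y : R) : (x + y)%:C = x%:C + y%:C.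
Proof. exact: rmorphD. Qed.

(** The form [dotmx] is [R[i]]-valued; the real part brings its square root down to [R], where a
    C*-norm takes its values. *)
Definition rownorm n (v : 'rV[R[i]]_n) : R := complex.Re (sqrtC (dotmx v v)).

Lemma rownormE n (v : 'rV[R[i]]_n) : (rownorm v)%:C = sqrtC (dotmx v v).
Proof. by rewrite RRe_real // ger0_real // sqrt_dnorm_ge0. Qed.

Lemma sqr_rownorm n (v : 'rV[R[i]]_n) : (rownorm v ^+ 2)%:C = dotmx v v.
Proof. by rewrite expr2 real_complexM rownormE -expr2 sqrtCK. Qed.

Lemma rownorm_ge0 n (v : 'rV[R[i]]_n) : 0 <= rownorm v.
Proof. by rewrite -lecR rownormE sqrt_dnorm_ge0. Qed.

Lemma rownorm0_eq0 n (v : 'rV[R[i]]_n) : rownorm v = 0 -> v = 0.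
Proof.
by move=> v0; apply/eqP; rewrite -(sqrt_dnorm_eq0 (@dotmx _ n)) -rownormE v0.
Qed.

Lemma rownorm0 n : rownorm (0 : 'rV[R[i]]_n) = 0.
Proof.
by apply: complexI; rewrite rownormE linear0r sqrtC0.
Qed.

Lemma normcE (z : R[i]) : (Normc.normc z)%:C = `|z|.
Proof. by []. Qed.

Lemma normc_ge0 (c : R[i]) : 0 <= Normc.normc c.
Proof. by rewrite -lecR normcE; exact: normr_ge0. Qed.

Lemma rownorm_CS n (u v : 'rV[R[i]]_n) :
  Normc.normc (dotmx u v) <= rownorm u * rownorm v.
Proof.
rewrite -lecR real_complexM !rownormE normcE.
by have [] := CauchySchwarz_sqrt (@dotmx _ n) u v.
Qed.

Lemma rownormD n (u v : 'rV[R[i]]_n) : rownorm (u + v) <= rownorm u + rownorm v.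
Proof.
rewrite -lecR real_complexD !rownormE.
by have [] := triangle_lerif (@dotmx _ n) u v.
Qed.

Lemma rownormZ n (c : R[i]) (v : 'rV[R[i]]_n) :
  rownorm (c *: v) = Normc.normc c * rownorm v.
Proof.
apply: complexI.
rewrite real_complexM !rownormE dnormZ rootCMl ?exprn_ge0 //.
by rewrite exprCK.
Qed.

Lemma rownorm_sum n (I : Type) (r : seq I) (v : I -> 'rV[R[i]]_n) :
  rownorm (\sum_(i <- r) v i) <= \sum_(i <- r) rownorm (v i).
Proof.
elim/big_rec2: _ => [|i y x _ le]; first by rewrite rownorm0.
by rewrite (le_trans (rownormD _ _)) // lerD2l.
Qed.

Lemma rownorm_delta n (i : 'I_n) : rownorm (delta_mx 0 i) = 1.
Proof.
apply: complexI; rewrite rownormE dotmxE trmx_delta.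
by rewrite map_delta_mx mul_delta_mx mxE !eqxx sqrtC1.
Qed.

Lemma dotmx_delta n (v : 'rV[R[i]]_n) i : dotmx v (delta_mx 0 i) = v 0 i.
Proof. by rewrite dotmxE trmx_delta map_delta_mx -colE mxE. Qed.

(** Cauchy-Schwarz against a basis vector. Together with [rownorm_le_sum] it compares the norm with
    the entries, so that limits can be taken entrywise. *)
Lemma le_entry_rownorm n (v : 'rV[R[i]]_n) i : Normc.normc (v 0 i) <= rownorm v.
Proof. by rewrite -dotmx_delta (le_trans (rownorm_CS _ _)) // rownorm_delta mulr1. Qed.

Lemma rownorm_le_sum n (v : 'rV[R[i]]_n) :
  rownorm v <= \sum_i Normc.normc (v 0 i).
Proof.
rewrite [v in leLHS]row_sum_delta (le_trans (rownorm_sum _ _)) //.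
by apply: ler_sum => i _; rewrite rownormZ rownorm_delta mulr1.
Qed.

End RowNorm.

(** * The operator norm on square matrices *)

(** Matrices act on row vectors from the right. The Euclidean norm on rows is chosen because the
    operator norm it induces satisfies the C*-identity. *)
HB.lock Definition opnorm (R : realType) n (M : 'M[R[i]]_n) : R :=
  sup [set rownorm (v *m M) | v in [set v | rownorm v <= 1]].

Section OpNorm.
Variable R : realType.
Variable n : nat.
Implicit Types M N : 'M[R[i]]_n.

Lemma opnorm_has_sup M :
  has_sup [set rownorm (v *m M) | v in [set v | rownorm v <= 1]].
Proof.
split; first by exists (rownorm (0 *m M)), 0; rewrite //= rownorm0 ler01.
exists (\sum_i rownorm (row i M)) => _ [v /= v1 <-].
rewrite mulmx_sum_row (le_trans (rownorm_sum _ _)) //.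
apply: ler_sum => i _; rewrite rownormZ ler_piMl ?rownorm_ge0 //.
exact: le_trans (le_entry_rownorm _ _) v1.
Qed.

Lemma opnorm_ge0 M : 0 <= opnorm M.
Proof.
rewrite opnorm.unlock; apply: sup_upper_bound (opnorm_has_sup M) _ _.
by exists 0; rewrite /= ?mul0mx rownorm0.
Qed.

Lemma rownorm_mulmx M v : rownorm (v *m M) <= opnorm M * rownorm v.
Proof.
have [/rownorm0_eq0 ->|v0] := eqVneq (rownorm v) 0.
  by rewrite mul0mx rownorm0 mulr0.
have vp : 0 < rownorm v by rewrite lt_def v0 rownorm_ge0.
rewrite -ler_pdivrMr // mulrC.
have nv : Normc.normc ((rownorm v)^-1%:C) = (rownorm v)^-1.
  by apply: complexI; rewrite normcE ger0_norm // lecR invr_ge0 ltW.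
rewrite -nv -rownormZ scalemxAl opnorm.unlock; apply: sup_upper_bound (opnorm_has_sup M) _ _.
by exists ((rownorm v)^-1%:C *: v); rewrite //= rownormZ nv mulVf.
Qed.

Lemma opnorm_le M K : 0 <= K ->
  (forall v, rownorm (v *m M) <= K * rownorm v) -> opnorm M <= K.
Proof.
move=> K0 MK; rewrite opnorm.unlock; apply: ge_sup; first by case: (opnorm_has_sup M).
by move=> _ [v /= v1 <-]; rewrite (le_trans (MK v)) // ler_piMr.
Qed.

Lemma opnormD M N : opnorm (M + N) <= opnorm M + opnorm N.
Proof.
apply: opnorm_le => [|v]; first by rewrite addr_ge0 // opnorm_ge0.
by rewrite mulmxDr mulrDl (le_trans (rownormD _ _)) // lerD // rownorm_mulmx.
Qed.

Lemma opnormM M N : opnorm (M *m N) <= opnorm M * opnorm N.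
Proof.
apply: opnorm_le => [|v]; first by rewrite mulr_ge0 // opnorm_ge0.
rewrite mulmxA; apply: le_trans (rownorm_mulmx _ _) _.
rewrite [opnorm M * _]mulrC -[leRHS]mulrA.
by apply: ler_wpM2l; [exact: opnorm_ge0 | exact: rownorm_mulmx].
Qed.

(** One inequality holds for every scalar; applied to [c^-1] and [c *: M] it gives the other. *)
Lemma opnormZ (c : R[i]) M : opnorm (c *: M) = Normc.normc c * opnorm M.
Proof.
have le_opnormZ d N : opnorm (d *: N) <= Normc.normc d * opnorm N.
  apply: opnorm_le => [|v]; first by rewrite mulr_ge0 ?normc_ge0 ?opnorm_ge0.
  by rewrite -scalemxAr rownormZ -mulrA ler_wpM2l ?normc_ge0 ?rownorm_mulmx.
apply/le_anti; rewrite le_opnormZ /=.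
have [->|c0] := eqVneq c 0; first by rewrite Normc.normc0 mul0r opnorm_ge0.
have nc0 : Normc.normc c != 0 by apply: contra_neq c0 => /Normc.eq0_normc.
have ncp : 0 < Normc.normc c by rewrite lt_def nc0 normc_ge0.
rewrite -ler_pdivlMl // -Normc.normcV.
by apply: le_trans (le_opnormZ _ _); rewrite scalerA mulVf // scale1r.
Qed.

Lemma le_entry_opnorm M i j : Normc.normc (M i j) <= opnorm M.
Proof.
have := rownorm_mulmx M (delta_mx 0 i); rewrite rownorm_delta mulr1 -rowE.
by apply: le_trans; have := le_entry_rownorm (row i M) j; rewrite mxE.
Qed.

Lemma opnorm_le_sum M : opnorm M <= \sum_i \sum_j Normc.normc (M i j).
Proof.
apply: opnorm_le => [|v].
  by apply: sumr_ge0 => i _; apply: sumr_ge0 => j _; apply: normc_ge0.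
rewrite mulmx_sum_row (le_trans (rownorm_sum _ _)) // mulr_suml.
apply: ler_sum => i _; rewrite rownormZ mulrC.
apply: ler_pM; rewrite ?rownorm_ge0 ?normc_ge0 ?le_entry_rownorm //.
by rewrite (le_trans (rownorm_le_sum _)) //; apply: ler_sum => j _; rewrite mxE.
Qed.

Lemma opnorm0_eq0 M : opnorm M = 0 -> M = 0.
Proof.
move=> M0; apply/matrixP => i j; rewrite mxE; apply: Normc.eq0_normc.
by apply/le_anti; rewrite normc_ge0 -M0 le_entry_opnorm.
Qed.

Definition conjtr M : 'M[R[i]]_n := map_mx Num.conj M^T.

Lemma conjtrK : involutive conjtr.
Proof. by move=> M; apply/matrixP => i j; rewrite !mxE conjCK. Qed.

Lemma conjtrM M N : conjtr (M *m N) = conjtr N *m conjtr M.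
Proof. by rewrite /conjtr trmx_mul map_mxM. Qed.

(* [dotmx u v = u v^*], so [|v M|^2 = v M M^* v^*]. *)
Lemma opnorm_conjtr_ge M : opnorm M ^+ 2 <= opnorm (M *m conjtr M).
Proof.
have [M0|M0] := eqVneq (opnorm M) 0; first by rewrite M0 expr0n opnorm_ge0.
suff h : opnorm M <= Num.sqrt (opnorm (M *m conjtr M)).
  by rewrite -(sqr_sqrtr (opnorm_ge0 (M *m conjtr M))) lerXn2r ?nnegrE ?opnorm_ge0 ?sqrtr_ge0.
apply: opnorm_le => [|v]; first exact: sqrtr_ge0.
rewrite -(ger0_norm (rownorm_ge0 v)) -sqrtr_sqr -sqrtrM ?opnorm_ge0 //.
rewrite -(ger0_norm (rownorm_ge0 (v *m M))) -sqrtr_sqr ler_wsqrtr //.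
have -> : rownorm (v *m M) ^+ 2 = Normc.normc (dotmx (v *m (M *m conjtr M)) v).
  apply: complexI; rewrite [RHS]/= normcE.
  suff -> : dotmx (v *m (M *m conjtr M)) v = dotmx (v *m M) (v *m M).
    by rewrite [LHS]sqr_rownorm ger0_norm // dnorm_ge0.
  by rewrite !dotmxE trmx_mul map_mxM !mulmxA.
by rewrite (le_trans (rownorm_CS _ _)) // expr2 mulrA ler_wpM2r ?rownorm_ge0 ?rownorm_mulmx.
Qed.

(** Cancel [opnorm N] in [opnorm N ^+ 2 <= opnorm N * opnorm (conjtr N)], then use that [conjtr] is
    an involution. *)
Lemma opnorm_conjtr M : opnorm (conjtr M) = opnorm M.
Proof.
have le_conjtr N : opnorm N <= opnorm (conjtr N).
  have := le_trans (opnorm_conjtr_ge N) (opnormM _ _).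
  have [->|N0] := eqVneq (opnorm N) 0; first by rewrite opnorm_ge0.
  by rewrite expr2 ler_pM2l // lt_def N0 opnorm_ge0.
by apply/le_anti; rewrite le_conjtr andbT -{2}[M]conjtrK le_conjtr.
Qed.

Lemma opnorm_Cstar M : opnorm (conjtr M *m M) = opnorm M ^+ 2.
Proof.
apply/le_anti; apply/andP; split.
  by rewrite (le_trans (opnormM _ _)) // opnorm_conjtr expr2.
by have := opnorm_conjtr_ge (conjtr M); rewrite conjtrK opnorm_conjtr.
Qed.

Lemma opnorm_complete (M_ : nat -> 'M[R[i]]_n) :
  (forall eps : R, 0 < eps -> exists k, forall m p, (k <= m)%N -> (k <= p)%N ->
     opnorm (M_ m - M_ p) < eps) ->
  exists L, forall eps : R, 0 < eps -> exists k, forall p, (k <= p)%N ->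
     opnorm (M_ p - L) < eps.
Proof.
move=> M_C.
have normc_le (z : R[i]) : Normc.normc z <= `|complex.Re z| + `|complex.Im z|.
  rewrite -[leRHS]ger0_norm ?addr_ge0 // -sqrtr_sqr.
  case: z => a b; rewrite /Normc.normc /= ler_wsqrtr // sqrrD !real_normK ?num_real //.
  by rewrite lerD2r lerDl mulrn_wge0 // mulr_ge0.
have Re_le (z : R[i]) : `|complex.Re z| <= Normc.normc z.
  by case: z => a b; rewrite /Normc.normc /= -sqrtr_sqr ler_wsqrtr // lerDl sqr_ge0.
have Im_le (z : R[i]) : `|complex.Im z| <= Normc.normc z.
  by case: z => a b; rewrite /Normc.normc /= -sqrtr_sqr ler_wsqrtr // lerDr sqr_ge0.
(* Stated for a contractive additive [h] so as to serve both real and imaginary parts. There are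
   finitely many entries, so the maximum of their ranks is a uniform one. *)
have part_lim (h : {additive R[i] -> R}) :
    (forall z, `|h z| <= Normc.normc z) ->
  exists L : 'I_n -> 'I_n -> R, forall eps, 0 < eps -> exists k, forall p, (k <= p)%N ->
     forall i j, `|h (M_ p i j) - L i j| < eps.
  move=> h_le.
  have /choice [L LP] (ij : 'I_n * 'I_n) : exists l, forall eps, 0 < eps ->
      exists k, forall p, (k <= p)%N -> `|h (M_ p ij.1 ij.2) - l| < eps.
    apply: cauchy_real_lim => eps eps0; have [N NP] := M_C _ eps0.
    exists N => m p Nm Np; apply: le_lt_trans (NP _ _ Nm Np).
    rewrite -raddfB (le_trans (h_le _)) //.
    by have := le_entry_opnorm (M_ m - M_ p) ij.1 ij.2; rewrite !mxE.
  exists (fun i j => L (i, j)) => eps eps0.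
  have /choice [N NP] ij := LP ij _ eps0.
  exists (\max_ij N ij) => p Np i j; apply: (NP (i, j)).
  exact: leq_trans (leq_bigmax (i, j)) Np.
have [LR LRP] := part_lim (@complex.Re R) Re_le.
have [LI LIP] := part_lim (@complex.Im R) Im_le.
exists (\matrix_(i, j) (LR i j +i* LI i j)) => eps eps0.
(* Each of the [n * n] entries contributes at most [d * 2]. The successor keeps the denominator
   nonzero for [n = 0] and the total strictly below [eps]. *)
pose d := eps / ((n * n).+1%:R * 2).
have d0 : 0 < d by rewrite divr_gt0 // mulr_gt0.
have [N1 N1P] := LRP _ d0; have [N2 N2P] := LIP _ d0.
exists (maxn N1 N2) => p; rewrite geq_max => /andP[/N1P p1 /N2P p2].
rewrite (le_lt_trans (opnorm_le_sum _)) //.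
rewrite (@le_lt_trans _ _ ((n * n)%:R * (d * 2))) //.
  have sum_le (F : 'I_n -> R) K : (forall i, F i <= K) -> \sum_i F i <= n%:R * K.
    by move=> FK; rewrite mulr_natl -[n in leRHS]card_ord -sumr_const ler_sum.
  rewrite natrM -mulrA; apply: (sum_le) => i; apply: (sum_le) => j.
  rewrite !mxE (le_trans (normc_le _)) //.
  rewrite !raddfB /=; have := p1 i j; have := p2 i j; lra.
have k0 : (n * n).+1%:R != 0 :> R by rewrite pnatr_eq0.
have -> : (n * n)%:R * (d * 2) = eps * ((n * n)%:R / (n * n).+1%:R).
  by rewrite /d invfM -!mulrA mulVf ?pnatr_eq0 // mulr1 mulrCA.
by rewrite -[ltRHS]mulr1 ltr_pM2l // ltr_pdivrMr ?ltr0n // mul1r ltr_nat.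
Qed.

End OpNorm.

(** * Matrix algebras as C*-algebras, with the normalised trace *)

Section MatrixCstar.
Variables (R : realType) (n : nat).
Implicit Types M N : 'M[R[i]]_n.+1.

Let conjtrD : {morph @conjtr R n.+1 : M N / M + N}.
Proof. by move=> M N; apply/matrixP => i j; rewrite !mxE rmorphD. Qed.

Let conjtrZ (c : R[i]) M : conjtr (c *: M) = Num.conj c *: conjtr M.
Proof. by apply/matrixP => i j; rewrite !mxE rmorphM. Qed.

HB.instance Definition _ := Algebra_isCstar.Build R 'M[R[i]]_n.+1
  (@conjtrK R n.+1) conjtrD conjtrZ (@conjtrM R n.+1)
  (@opnormD R n.+1) (@opnormZ R n.+1) (@opnorm0_eq0 R n.+1) (@opnormM R n.+1)
  (@opnorm_Cstar R n.+1) (@opnorm_complete R n.+1).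

Definition ntrace M : R[i] := n.+1%:R^-1 * \tr M.

Fact ntrace_is_scalar : scalar ntrace.
Proof. by move=> c M N; rewrite /ntrace linearP mulrDr mulrCA. Qed.

HB.instance Definition _ :=
  GRing.isLinear.Build R[i] 'M[R[i]]_n.+1 R[i] *%R ntrace ntrace_is_scalar.

Lemma ntrace1 : ntrace 1 = 1.
Proof. by rewrite /ntrace mxtrace1 mulVf ?pnatr_eq0. Qed.

(** Positivity: the trace of [star M * M] is the sum of the squared moduli of the entries of [M]. *)
Lemma ntrace_tracial_state : tracial_state (ntrace : {scalar 'M[R[i]]_n.+1}).
Proof.
split; last by move=> M N; congr (_ * _); apply: mxtrace_mulC.
split; last exact: ntrace1.
move=> M; rewrite mulr_ge0 ?invr_ge0 ?ler0n //; apply: sumr_ge0 => i _.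
by rewrite mxE sumr_ge0 // => j _; rewrite !mxE mulrC mul_conjC_ge0.
Qed.

End MatrixCstar.

(** * Tracial states on a generated subalgebra, from a representation *)

Section Pullback.
Variables (R : realType) (A B : cstarType R) (S : set A).
Variables (phi : {lrmorphism A -> B}) (f : {scalar B}).

Lemma tracial_state_pullback : star_morphism phi -> tracial_state f ->
  exists tau : {scalar cstar_sub S},
    tracial_state tau /\ forall w, tau w = f (phi (val w)).
Proof.
move=> phiS fT; pose g (w : cstar_sub S) : R[i] := f (phi (val w)).
have g_scalar : scalar g by move=> c x y; rewrite /g !linearP.
pose gL := GRing.isLinear.Build R[i] (cstar_sub S) R[i] *%R g g_scalar.
pose tau : {scalar cstar_sub S} := HB.pack g gL.
exists tau; split=> //; split; last first.
  by move=> x y; rewrite /= /g !rmorphM (tracial_stateC fT).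
split; last by rewrite /= /g !rmorph1 (state1 fT).
move=> x; have := state_ge0 fT (phi (val x)).
have <- : phi (star (val x)) = star (phi (val x)) := star_morphism_star phiS _.
by rewrite -rmorphM.
Qed.

End Pullback.

(** * The null ideal of a tracial state *)

(** The values at 0 and 1 force [K] and [w] to be real. If [w] were nonzero, [r = - ((K + 1) / w)]
    would give the value -1. *)
Lemma affine_ge0_eq0 (C : numFieldType) (K w : C) :
  (forall r, r \is Num.real -> 0 <= K + r * w) -> w = 0.
Proof.
move=> Kw; have K0 : 0 <= K by have := Kw 0 (real0 _); rewrite mul0r addr0.
have wr : w \is Num.real.
  have := ger0_real (Kw 1 (real1 _)); rewrite mul1r => Kwr.
  by rewrite -(addKr K w) rpredD ?rpredN // ger0_real.
apply/eqP; apply: contraT => w0.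
have := Kw (- ((K + 1) / w)); rewrite mulNr divfK // opprD addNKr.
by rewrite oppr_ge0 ler10; apply; rewrite realN realM ?realV // realD // ger0_real.
Qed.

Section NullIdeal.
Variables (R : realType) (A : cstarType R) (t : {scalar A}).
Hypothesis tT : tracial_state t.

Let tC (x y : A) : t (x * y) = t (y * x).
Proof. exact: tracial_stateC. Qed.

Let t_ge0 (x : A) : 0 <= t (star x * x).
Proof. exact: state_ge0 tT x. Qed.

(** Equality modulo the null ideal of [t], that is, in its GNS representation. Testing against every
    [z] avoids forming the quotient. *)
Definition null_mod (x y : A) := forall z, t (z * x) = t (z * y).

Lemma null_mod_sym x y : null_mod x y -> null_mod y x.
Proof. by move=> xy z; rewrite xy. Qed.

Lemma null_mod_trans y x z : null_mod x y -> null_mod y z -> null_mod x z.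
Proof. by move=> xy yz w; rewrite xy. Qed.

(** The right factor is replaced directly; traciality then rotates the left factor to the right end,
    where it can be replaced too. *)
Lemma null_modM x x' y y' : null_mod x x' -> null_mod y y' ->
  null_mod (x * y) (x' * y').
Proof.
move=> xx' yy' z; rewrite mulrA yy' tC mulrA xx'.
by rewrite -mulrA tC -mulrA.
Qed.

(* Cauchy-Schwarz. The form [t (star y * x)] is not known to be hermitian, so
   the positivity of [t] is tested against both [x] and ['i *: x]. *)
Lemma state_null (x y : A) : t (star x * x) = 0 -> t (y * x) = 0.
Proof.
move=> x0; rewrite -[y]starK; move: (star y) => {}y.
have h c : c * t (star y * x) + Num.conj c * t (star x * y) = 0.
  apply: (@affine_ge0_eq0 _ (t (star y * y))) => r r_real.
  have := t_ge0 (y + (r * c) *: x).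
  rewrite starD starZ mulrDl !mulrDr !linearD /= -!scalerAr -!scalerAl !linearZ /=.
  rewrite x0 !mulr0 addr0 rmorphM /= (conj_Creal r_real) -!addrA => le.
  by rewrite !mulrA.
have := h 1; have := h 'i; rewrite rmorph1 conjCi !mul1r mulNr -mulrBr.
move/eqP; rewrite mulf_eq0 (negPf (neq0Ci _)) /= subr_eq0 => /eqP <-.
by move/eqP; rewrite -mulr2n mulrn_eq0 /= => /eqP.
Qed.

(** Reduces a relation modulo the null ideal to one number, which for words is computable from the
    correlation. *)
Lemma null_mod_sub x y : t (star (x - y) * (x - y)) = 0 -> null_mod x y.
Proof. by move=> /state_null xy z; apply/eqP; rewrite -subr_eq0 -linearB -mulrBr xy. Qed.

End NullIdeal.

(** * Correlations and the values of their states on words *)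

Lemma sum4_only (V : finType) (L : nmodType) (F : V -> V -> V -> V -> L) a b c d :
  (forall x y z t, ~~ [&& x == a, y == b, z == c & t == d] -> F x y z t = 0) ->
  \sum_x \sum_y \sum_z \sum_t F x y z t = F a b c d.
Proof.
move=> F0; rewrite (bigD1 a) //= [X in _ + X]big1 => [|x xa]; last first.
  rewrite big1 // => y _; rewrite big1 // => z _; rewrite big1 // => t _.
  by rewrite F0 // (negPf xa).
rewrite addr0 (bigD1 b) //= [X in _ + X]big1 => [|y yb]; last first.
  rewrite big1 // => z _; rewrite big1 // => t _.
  by rewrite F0 // (negPf yb) andbF.
rewrite addr0 (bigD1 c) //= [X in _ + X]big1 => [|z zc]; last first.
  by rewrite big1 // => t _; rewrite F0 // (negPf zc) !andbF.
rewrite addr0 (bigD1 d) //= [X in _ + X]big1 ?addr0 // => t td.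
by rewrite F0 // (negPf td) !andbF.
Qed.

Section Implements.
Variables (R : realType) (V : finType) (A : cstarType R) (u : V -> V -> A).
Local Notation n := #|V|.

(** The coordinate along the unit [(a, a')] tensor [(b, b')]: Kronecker rows are indexed by
    [(a, b)], columns by [(a', b')]. *)
Definition entry (M : 'M[R[i]]_(n * n)) (a a' b b' : V) : R[i] :=
  M (mxtens_index (enum_rank a, enum_rank b))
    (mxtens_index (enum_rank a', enum_rank b')).

Lemma entry_mxunit x x' y y' a a' b b' :
  entry (mxunit R x x' *t mxunit R y y') a a' b b' =
  [&& a == x, a' == x', b == y & b' == y']%:R.
Proof.
rewrite /entry tensmxE !mxE !(inj_eq enum_rank_inj) -natrM mulnb.
by rewrite -!andbA.
Qed.

(** The image of a tensor of matrix units under the map given by [tau], that is, a block of its Choi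
    matrix. *)
Definition choi (tau : {scalar qut u}) (x x' y y' : V) : 'M[R[i]]_(n * n) :=
  \sum_a \sum_a' \sum_b \sum_b'
    tau (qut_word u a x a' x' * qut_word u b' y' b y) *:
      (mxunit R a a' *t mxunit R b b').

Lemma entry_choi tau x x' y y' a a' b b' :
  entry (choi tau x x' y y') a a' b b' =
  tau (qut_word u a x a' x' * qut_word u b' y' b y).
Proof.
rewrite /entry /choi summxE; under eq_bigr do rewrite summxE.
under eq_bigr do under eq_bigr do rewrite summxE.
under eq_bigr do under eq_bigr do under eq_bigr do rewrite summxE.
under eq_bigr do under eq_bigr do under eq_bigr do under eq_bigr do
  rewrite mxE -/(entry _ _ _ _ _) entry_mxunit.
rewrite (sum4_only (a := a) (b := a') (c := b) (d := b')) ?eqxx ?mulr1 //.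
move=> z z' t t'; rewrite ![_ == z]eq_sym ![_ == z']eq_sym ![_ == t]eq_sym ![_ == t']eq_sym.
by move=> /negPf ->; rewrite mulr0.
Qed.

(** Tensors of matrix units form a basis, so the prescribed images extend linearly. *)
Lemma implements_ex (tau : {scalar qut u}) :
  exists Gamma : {linear 'M[R[i]]_(n * n) -> 'M[R[i]]_(n * n)},
    implements tau Gamma.
Proof.
pose g (M : 'M[R[i]]_(n * n)) : 'M[R[i]]_(n * n) :=
  \sum_x \sum_x' \sum_y \sum_y' entry M x x' y y' *: choi tau x x' y y'.
have g_linear : linear g.
  move=> c M N; rewrite /g scaler_sumr -big_split; apply: eq_bigr => x _.
  rewrite scaler_sumr -big_split; apply: eq_bigr => x' _.
  rewrite scaler_sumr -big_split; apply: eq_bigr => y _.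
  rewrite scaler_sumr -big_split; apply: eq_bigr => y' _.
  by rewrite /entry !mxE scalerDl scalerA.
pose gL := GRing.isLinear.Build _ _ _ _ g g_linear.
pose Gamma : {linear 'M[R[i]]_(n * n) -> 'M[R[i]]_(n * n)} := HB.pack g gL.
exists Gamma => x x' y y'; rewrite /= /g.
rewrite (sum4_only (a := x) (b := x') (c := y) (d := y')).
  by rewrite entry_mxunit !eqxx scale1r.
by move=> a a' b b' /negPf h; rewrite entry_mxunit h scale0r.
Qed.

(** The coordinates of the images are the values of the state on products of two words, so the
    correlation determines these values. *)
Lemma implements_inj (tau tau' : {scalar qut u}) Gamma :
  implements tau Gamma -> implements tau' Gamma ->
  forall a x a' x' b' y' b y,
    tau (qut_word u a x a' x' * qut_word u b' y' b y) =
    tau' (qut_word u a x a' x' * qut_word u b' y' b y).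
Proof.
move=> h h' a x a' x' b' y' b y; rewrite -!entry_choi.
by congr (entry _ _ _ _ _); rewrite /choi -h -h'.
Qed.

Lemma star_qut_word a x b y : star (qut_word u a x b y) = qut_word u b y a x.
Proof. by apply: val_inj; rewrite /= starM starK. Qed.

(* Since [\sum_a u_(z,a) u_(z,a)^* = 1], the words multiply like
   [u_x^* u_y = (u_x^* u_z) (u_z^* u_y)] once the off-diagonal ones vanish. *)
Lemma qut_word_mul (t : {scalar qut u}) x y z :
  tracial_state t -> is_biunitary (vmx u) ->
  (forall a, a != z ->
     t (qut_word u y y z a * qut_word u z a y y) = 0) ->
  null_mod t (qut_word u x x y y) (qut_word u x x z z * qut_word u z z y y).
Proof.
move=> tT [[_ uu] _] t0.
have s1 : \sum_a u z a * star (u z a) = 1.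
  have /matrixP/(_ (enum_rank z) (enum_rank z)) := uu.
  rewrite !mxE eqxx mulr1n => <-; rewrite (reindex _ (onW_bij _ (@enum_val_bij V))) /=.
  by apply: eq_bigr => i _; rewrite !mxE enum_rankK.
have -> : qut_word u x x y y = \sum_a qut_word u x x z a * qut_word u z a y y.
  apply: val_inj; rewrite [RHS]raddf_sum /= -[X in X * _ = _]mulr1 -s1 mulr_sumr mulr_suml.
  by apply: eq_bigr => a _; rewrite /= !mulrA.
move=> w; rewrite (bigD1 z) //= mulrDr linearD /= mulr_sumr linear_sum /=.
rewrite [X in _ + X]big1 ?addr0 // => a az.
rewrite mulrA; apply: (state_null tT).
by rewrite star_qut_word t0.
Qed.

End Implements.

(** * Diagonal solutions of the game relations *)

Lemma cstar_star0 (R : realType) (B : cstarType R) : star (0 : B) = 0.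
Proof. by apply: (addIr (star (0 : B))); rewrite -starD !add0r. Qed.

Lemma cstar_star1 (R : realType) (B : cstarType R) : star (1 : B) = 1.
Proof. by rewrite -[LHS]mul1r -[X in X * _]starK -starM mul1r starK. Qed.

Section DiagonalIso.
Variables (R : realType) (V : finType) (B : cstarType R) (w : V -> B).
Hypotheses (w_iso : forall x, star (w x) * w x = 1).
Hypotheses (w_coiso : forall x, w x * star (w x) = 1).

Definition diag_family (a x : V) : B := if a == x then w x else 0.

Lemma diag_familyE x : diag_family x x = w x.
Proof. by rewrite /diag_family eqxx. Qed.

Lemma diag_family0 a x : a != x -> diag_family a x = 0.
Proof. by rewrite /diag_family => /negPf ->. Qed.

Lemma vmx_diag_family i j :
  vmx diag_family i j = if i == j then w (enum_val j) else 0.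
Proof. by rewrite mxE /diag_family (inj_eq enum_val_inj). Qed.

(** A diagonal matrix is its own transpose, so one unitarity check serves for both. *)
Lemma diag_family_biunitary : is_biunitary (vmx diag_family).
Proof.
have vmxT : (vmx diag_family)^T = vmx diag_family.
  by apply/matrixP => i j; rewrite mxE !vmx_diag_family eq_sym; case: eqP => // ->.
suff H : Defs.is_unitary (vmx diag_family) by split=> //; rewrite vmxT.
split; apply/matrixP => i j; rewrite !mxE (bigD1 i) //= big1 ?addr0.
- rewrite mxE !vmx_diag_family eqxx; case: eqP => [->|_]; rewrite ?w_iso ?mulr0 //.
- by move=> k ki; rewrite mxE !vmx_diag_family (negPf ki) cstar_star0 mul0r.
- rewrite [adjmx _ _ _]mxE !vmx_diag_family eqxx [j == i]eq_sym; case: eqP => [->|_].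
    by rewrite w_coiso.
  by rewrite cstar_star0 mulr0.
- by move=> k ki; rewrite vmx_diag_family eq_sym (negPf ki) mul0r.
Qed.

Lemma diag_family_mul_star0 a x b y : (a != x) || (b != y) ->
  diag_family a x * star (diag_family b y) = 0.
Proof.
by case/orP=> /diag_family0 ->; rewrite ?mul0r // cstar_star0 mulr0.
Qed.

(** A product of an entry with an adjoint entry can be nonzero only for [a = x] and [b = y]; then
    [e a b] and [e x y] agree and neither relation applies. *)
Lemma diag_family_iso_relations (e : rel V) : iso_relations e diag_family.
Proof.
split; first exact: diag_family_biunitary.
- move=> a b x y xy ab; apply: diag_family_mul_star0; apply: contraNT ab.
  by rewrite negb_or !negbK => /andP[/eqP-> /eqP->].
- move=> a b x y xy ab; apply: diag_family_mul_star0; apply: contraNT xy.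
  by rewrite negb_or !negbK => /andP[/eqP<- /eqP<-].
Qed.

End DiagonalIso.

(** * Anticommuting self-adjoint unitaries in dimension two *)

Section Pauli.
Variable R : realType.
Local Notation M2 := 'M[R[i]]_2.

Definition pauliX : M2 := \matrix_(i, j) (i != j)%:R.
Definition pauliZ : M2 := \matrix_(i, j) ((i == j)%:R * (-1) ^+ i).

Lemma star_pauliX : star pauliX = pauliX.
Proof. by apply/matrixP => i j; rewrite !mxE rmorph_nat eq_sym. Qed.

Lemma star_pauliZ : star pauliZ = pauliZ.
Proof.
apply/matrixP => i j; rewrite !mxE rmorphM /= rmorph_nat rmorphXn rmorphN1 eq_sym.
by case: eqP => [->|]; rewrite ?mul0r.
Qed.

Lemma pauliXX : pauliX * pauliX = 1.
Proof.
apply/matrixP => i j; rewrite !mxE !big_ord_recl big_ord0 !mxE.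
by case: i => [[|[|//]] ?]; case: j => [[|[|//]] ?] /=; ring.
Qed.

Lemma pauliZZ : pauliZ * pauliZ = 1.
Proof.
apply/matrixP => i j; rewrite !mxE !big_ord_recl big_ord0 !mxE.
by case: i => [[|[|//]] ?]; case: j => [[|[|//]] ?] /=; ring.
Qed.

Lemma pauliZX : pauliZ * pauliX = - (pauliX * pauliZ).
Proof.
apply/matrixP => i j; rewrite !mxE !big_ord_recl !big_ord0 !mxE.
by case: i => [[|[|//]] ?]; case: j => [[|[|//]] ?] /=; ring.
Qed.

End Pauli.

(** * The obstruction to locality *)

(** Only the values of [t] on products of two words are prescribed. They suffice to derive, modulo
    the null ideal, every relation used below except commutation, which comes from the abelian
    factor. *)
Lemma anticommuting_not_factors_abelian (R : realType) (V : finType) (A : cstarType R)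
    (u : V -> V -> A) (t : {scalar qut u}) (B : cstarType R) (f : {scalar B})
    (w : V -> B) (p q r : V) (v := diag_family w) :
  is_biunitary (vmx u) -> tracial_state t -> factors_abelian t -> f 1 = 1 ->
  (forall a x a' x' b' y' b y,
    t (qut_word u a x a' x' * qut_word u b' y' b y) =
    f (star (v a x) * v a' x' * (star (v b' y') * v b y))) ->
  w p = 1 -> star (w q) = w q -> star (w r) = w r ->
  w q * w q = 1 -> w r * w r = 1 -> w r * w q = - (w q * w r) -> False.
Proof.
move=> uu tT [C [pi [g [C_ab piM _ t_pi]]]] f1 tE wp q_sa r_sa qq rr rq.
pose c x y : qut u := qut_word u x x y y.
have cE x y x' y' : t (c x y * c x' y') = f (star (w x) * w y * (star (w x') * w y')).
  by rewrite tE /v !diag_familyE.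
have c_star x y : star (c x y) = c y x by exact: star_qut_word.
(* The words through an off-diagonal [u z a] are null because [diag_family] vanishes there. *)
have c_mul x z y : null_mod t (c x y) (c x z * c z y).
  rewrite /c; apply: (qut_word_mul x tT uu) => a az.
  rewrite tE /v [diag_family _ z a]diag_family0 1?eq_sym //.
  by rewrite mulr0 mul0r linear0.
(* The squared distance from [c x y] to [s *: c y x] expands to [1 - s^2 - s^2 + s^2 = 0]. This is
   used with [s = 1] and [s = -1]. *)
have cJ x y (s : R[i]) : s * s = 1 -> Num.conj s = s ->
    t (c x y * c x y) = s -> t (c y x * c y x) = s ->
    t (c x y * c y x) = 1 -> t (c y x * c x y) = 1 ->
    null_mod t (c x y) (s *: c y x).
  move=> ss sJ xx yy xy yx; apply: (null_mod_sub tT).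
  have -> : star (c x y - s *: c y x) = c y x - s *: c x y.
    by rewrite -scaleNr starD starZ !c_star rmorphN /= sJ scaleNr.
  rewrite mulrBl !mulrBr -!scalerAl -!scalerAr !linearB /= !linearZ /=.
  rewrite xx yy xy yx /GRing.scale /= !mulrN opprK !mulr1 ss.
  by rewrite subrr addNr addr0.
have c_comm x y z z' : null_mod t (c x y * c z z') (c z z' * c x y).
  by move=> m; rewrite !t_pi !(star_morphismM piM) (C_ab (pi (c x y))).
have cpq : null_mod t (c p q) (c q p).
  rewrite -[c q p]scale1r; apply: cJ; rewrite ?mulr1 ?rmorph1 //;
  by rewrite cE wp ?q_sa ?cstar_star1 !(mulr1, mul1r) qq f1.
have cpr : null_mod t (c r p) (c p r).
  rewrite -[c p r]scale1r; apply: cJ; rewrite ?mulr1 ?rmorph1 //;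
  by rewrite cE wp ?r_sa ?cstar_star1 !(mulr1, mul1r) rr f1.
have qrrq : t (c q r * c r q) = 1 by rewrite cE q_sa r_sa -mulrA (mulrA (w r)) rr mul1r qq f1.
have rqqr : t (c r q * c q r) = 1 by rewrite cE q_sa r_sa -mulrA (mulrA (w q)) qq mul1r rr f1.
(* Anticommutation makes the square of [w q * w r] equal to -1. *)
have qrqr : t (c q r * c q r) = -1.
  by rewrite cE q_sa -mulrA (mulrA (w r)) rq mulNr mulrN -mulrA rr mulr1 qq linearN /= f1.
have rqrq : t (c r q * c r q) = -1.
  rewrite cE r_sa -mulrA (mulrA (w q)) -[w q * w r]opprK -rq.
  by rewrite mulNr mulrN -mulrA qq mulr1 rr linearN /= f1.
have cqr : null_mod t (c q r) ((-1) *: c r q).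
  by apply: cJ; rewrite ?mulrNN ?mulr1 ?rmorphN1.
have crq : null_mod t (c r q) (c q r).
  apply: null_mod_trans (c_mul r p q) _.
  apply: null_mod_trans (null_modM tT cpr cpq) _.
  apply: null_mod_trans (c_comm _ _ _ _) _.
  exact: null_mod_sym (c_mul q p r).
(* Tested against [c r q], the two relations between [c q r] and [c r q] give [1 = -1]. *)
have := cqr (c r q); rewrite -scalerAr linearZ /= (crq (c r q)) rqqr mulr1.
by move=> /eqP; rewrite -subr_eq0 opprK -mulr2n pnatr_eq0.
Qed.

(** * The Pauli correlation on three vertices *)

Theorem theorem6 (R : realType) (V : finType) (e : rel V)
  (e_sym : symmetric e) (e_irr : irreflexive e) (V_ge3 : (3 <= #|V|)%N)
  (A : cstarType R) (u : V -> V -> A) (A_univ : iso_universal e u) :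
  nonlocal_symmetry u.
Proof.
have /card_gt2P[p [q [r [_ [pq qr rp]]]]] := V_ge3.
pose w x : 'M[R[i]]_2 := if x == q then pauliX R else if x == r then pauliZ R else 1.
have wp : w p = 1 by rewrite /w (negPf pq) eq_sym (negPf rp).
have wq : w q = pauliX R by rewrite /w eqxx.
have wr : w r = pauliZ R by rewrite /w eq_sym (negPf qr) eqxx.
have w_unitary x : star (w x) * w x = 1 /\ w x * star (w x) = 1.
  rewrite /w; case: ifP => _; first by rewrite star_pauliX pauliXX.
  by case: ifP => _; rewrite ?star_pauliZ ?pauliZZ // cstar_star1 mulr1.
have w_rel := diag_family_iso_relations (fun x => (w_unitary x).1)
  (fun x => (w_unitary x).2) e.
(* Universality turns the diagonal solution into a representation of the game algebra on 2 by 2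
   matrices. *)
have [phi [phi_star phi_u]] := iso_universal_map A_univ w_rel.
have phi_word a x b y :
    phi (val (qut_word u a x b y)) = star (diag_family w a x) * diag_family w b y.
  have <- : phi (star (u a x)) = star (diag_family w a x).
    by rewrite -phi_u; apply: (star_morphism_star phi_star).
  by rewrite -phi_u; apply: rmorphM.
have val_qutM (y z : qut u) : phi (val (y * z)) = phi (val y) * phi (val z).
  exact: rmorphM phi _ _.
(* The argument 1 of [ntrace_tracial_state] stands for matrices of size 2. *)
have [tau [tauT tauE]] :=
  tracial_state_pullback (qut_words u) phi_star (@ntrace_tracial_state R 1).
have [Gamma Gamma_tau] := implements_ex tau.
exists Gamma; split; first by exists tau.
case=> t [tT t_ab Gamma_t].
apply: (anticommuting_not_factors_abelian (w := w) (p := p) (q := q) (r := r)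
  (iso_biunitary (iso_universal_rel A_univ)) tT t_ab (@ntrace1 R 1)).
(* Both [t] and [tau] implement [Gamma], hence agree on products of two words, where [tau] is
   computed through [phi]. *)
- move=> a x a' x' b' y' b y; rewrite (implements_inj Gamma_t Gamma_tau) tauE.
  by rewrite val_qutM !phi_word.
- exact: wp.
- by rewrite wq star_pauliX.
- by rewrite wr star_pauliZ.
- by rewrite wq pauliXX.
- by rewrite wr pauliZZ.
- by rewrite wq wr pauliZX.
Qed.
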